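(* Let $k$ be a field of characteristic $0$ and let $\Theta$ be the variety of all Lie algebras over $k$. Let $\varphi\neq \mathrm{id}_k$ be an automorphism of the field $k$, and fix $\lambda\in k$ with $\varphi(\lambda)\neq\lambda$. Let $L=L(x_1,x_2)$ be the free Lie algebra over $k$ on two free generators, let $T$ be the ideal of $L$ generated by $$t=\lambda\,[x_1,[x_1,[[x_1,x_2],x_2]]]+[[x_1,[x_1,x_2]],[x_1,x_2]]$$ together with $L^6$, and let $H=L/T$. Let $H^{\ast}_W$ be the Lie algebra with the same underlying set, zero, addition and Lie bracket as $H$, but with multiplication by scalars given by $\mu\ast h=\varphi(\mu)h$ for $\mu\in k$, $h\in H$. Then $H$ and $H^{\ast}_W$ are not geometrically equivalent.
   Context: $L^j$ denotes the ideal of $L$ spanned by all Lie monomials in the free generators of total degree at least $j$. Homomorphisms are $k$-linear Lie algebra homomorphisms. Let $X_0=\{x_1,x_2,\ldots\}$ be a countable set; for finite $X\subset X_0$ let $F(X)$ be the free algebra of $\Theta$ (free Lie algebra over $k$) on $X$. For $H\in\Theta$ and $S\subseteq F(X)$ put $S''_H=\bigcap\{\ker\mu\mid\mu\in\mathrm{Hom}(F(X),H),\ S\subseteq\ker\mu\}$, where $\ker\mu$ is the ideal $\mu^{-1}(0)$. Algebras $H_1,H_2\in\Theta$ are geometrically equivalent if $S''_{H_1}=S''_{H_2}$ for every finite $X\subset X_0$ and every $S\subseteq F(X)$. *)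

(* Defs.v *)
From HB Require Import structures.
From mathcomp Require Import all_boot all_order all_algebra.
From mathcomp Require Import finmap.
From mathcomp Require Import boolp classical_sets.

Set Implicit Arguments.
Unset Strict Implicit.
Unset Printing Implicit Defensive.

Import GRing.Theory.

Local Open Scope classical_set_scope.
Local Open Scope ring_scope.
Local Open Scope quotient_scope.

HB.mixin Record Lmodule_isLie (k : fieldType) V of GRing.Lmodule k V := {
  lieb : V -> V -> V;
  lieb_linearl : forall (a : k) (x y z : V),
    lieb (a *: x + y) z = a *: lieb x z + lieb y z;
  lieb_linearr : forall (a : k) (x y z : V),
    lieb z (a *: x + y) = a *: lieb z x + lieb z y;
  liebb : forall x : V, lieb x x = 0;
  lieb_jacobi : forall x y z : V,
    lieb x (lieb y z) + lieb y (lieb z x) + lieb z (lieb x y) = 0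
}.

#[short(type="lieType")]
HB.structure Definition Lie (k : fieldType) :=
  {V of GRing.Lmodule k V & Lmodule_isLie k V}.

Notation "[ 'lie' x , y ]" := (lieb x y)
  (at level 0, x at level 99, y at level 99, format "[ 'lie'  x ,  y ]")
  : ring_scope.

Section LieBasics.
Variables (k : fieldType) (L : lieType k).
Implicit Types (x y z : L) (S I : set L).

Lemma liebDl x y z : [lie x + y, z] = [lie x, z] + [lie y, z].
Proof. by rewrite -[x]scale1r lieb_linearl !scale1r. Qed.

Lemma liebDr x y z : [lie z, x + y] = [lie z, x] + [lie z, y].
Proof. by rewrite -[x]scale1r lieb_linearr !scale1r. Qed.

Lemma lieb0l z : [lie 0, z] = 0.
Proof. by apply: (addrI [lie 0, z]); rewrite -liebDl !addr0. Qed.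

Lemma lieb0r z : [lie z, 0] = 0.
Proof. by apply: (addrI [lie z, 0]); rewrite -liebDr !addr0. Qed.

Lemma liebZl (a : k) x z : [lie a *: x, z] = a *: [lie x, z].
Proof. by rewrite -[a *: x]addr0 lieb_linearl lieb0l addr0. Qed.

Lemma liebZr (a : k) x z : [lie z, a *: x] = a *: [lie z, x].
Proof. by rewrite -[a *: x]addr0 lieb_linearr lieb0r addr0. Qed.

Lemma liebNl x z : [lie - x, z] = - [lie x, z].
Proof. by rewrite -scaleN1r liebZl scaleN1r. Qed.

Lemma liebNr x z : [lie z, - x] = - [lie z, x].
Proof. by rewrite -scaleN1r liebZr scaleN1r. Qed.

Lemma liebC x y : [lie x, y] = - [lie y, x].
Proof.
apply/eqP; rewrite -addr_eq0; apply/eqP.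
by have := liebb (x + y); rewrite liebDl !liebDr !liebb add0r addr0.
Qed.

Definition is_subspace (S : set L) : Prop :=
  S 0 /\ forall (a : k) u v, S u -> S v -> S (a *: u + v).

Definition is_lie_ideal (I : set L) : Prop :=
  is_subspace I /\ forall x u, I u -> I [lie x, u].

Definition lin_span (S : set L) : set L := smallest is_subspace S.

Definition ideal_span (S : set L) : set L := smallest is_lie_ideal S.

Lemma ideal_span_ideal S : is_lie_ideal (ideal_span S).
Proof.
split; first split.
- by move=> A [[[A0 _] _] _].
- by move=> a u v Su Sv A hA; have [[[_ h] _] _] := hA; apply: h;
    [exact: Su | exact: Sv].
- by move=> x u Su A hA; have [[_ h] _] := hA; apply: h; exact: Su.
Qed.

End LieBasics.

Definition lie_hom (k : fieldType) (U V : lieType k) (f : U -> V) : Prop :=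
  linear f /\ {morph f : x y / [lie x, y]}.

Definition lie_ker (k : fieldType) (U V : lieType k) (f : U -> V) : set U :=
  f @^-1` [set 0].

Record lieIdeal (k : fieldType) (L : lieType k) := LieIdeal {
  ideal_set :> set L;
  ideal_setP : is_lie_ideal ideal_set
}.

Definition ideal_gen (k : fieldType) (L : lieType k) (S : set L) : lieIdeal L :=
  LieIdeal (ideal_span_ideal S).

Section LieQuotient.
Variables (k : fieldType) (L : lieType k) (I : lieIdeal L).

Local Notation inI := (ideal_set I).

Let I0 : inI 0. Proof. exact: (ideal_setP I).1.1. Qed.
Let ID u v : inI u -> inI v -> inI (u + v).
Proof.
by move=> Iu Iv; rewrite -[u]scale1r; exact: (ideal_setP I).1.2.
Qed.
Let IZ a u : inI u -> inI (a *: u).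
Proof.
by move=> Iu; rewrite -[_ *: _]addr0; exact: (ideal_setP I).1.2.
Qed.
Let IN u : inI u -> inI (- u).
Proof. by rewrite -scaleN1r; exact: IZ. Qed.
Let IBr x u : inI u -> inI [lie x, u].
Proof. exact: (ideal_setP I).2. Qed.
Let IBl x u : inI u -> inI [lie u, x].
Proof. by move=> Iu; rewrite liebC; exact/IN/IBr. Qed.

Definition lie_quot_equiv : rel L := fun x y => `[< inI (x - y) >].

Lemma lie_quot_equiv_class : equiv_class_of lie_quot_equiv.
Proof.
split=> [x|x y|y x z].
- by apply/asboolP; rewrite subrr.
- by apply/asboolP/asboolP => h; rewrite -opprB; exact: IN.
- move=> /asboolP h1 /asboolP h2; apply/asboolP.
  by have := ID h1 h2; rewrite addrA addrNK.
Qed.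

Canonical lie_quot_equiv_rel := EquivRelPack lie_quot_equiv_class.
Canonical lie_quot_encModRel := defaultEncModRel lie_quot_equiv.

Definition lie_quot : Type := {eq_quot lie_quot_equiv}.

HB.instance Definition _ : EqQuotient L lie_quot_equiv lie_quot :=
  EqQuotient.on lie_quot.
HB.instance Definition _ := Choice.on lie_quot.

Definition lie_quot_pi (x : L) : lie_quot := \pi_lie_quot x.

Lemma lie_quot_piP x y : lie_quot_pi x = lie_quot_pi y <-> inI (x - y).
Proof.
split=> [/eqP|h]; first by rewrite piE => /asboolP.
by apply/eqP; rewrite piE; apply/asboolP.
Qed.

Lemma lie_quot_piW (P : lie_quot -> Prop) :
  (forall x, P (lie_quot_pi x)) -> forall u, P u.
Proof. by move=> h u; rewrite -[u]reprK; exact: h. Qed.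

Let repr_pi x : inI (repr (lie_quot_pi x) - x).
Proof. by apply/lie_quot_piP; rewrite /lie_quot_pi reprK. Qed.

Let qzero := lie_quot_pi 0.
Let qopp (u : lie_quot) := lie_quot_pi (- repr u).
Let qadd (u v : lie_quot) := lie_quot_pi (repr u + repr v).
Let qscale (a : k) (u : lie_quot) := lie_quot_pi (a *: repr u).
Let qbr (u v : lie_quot) := lie_quot_pi [lie repr u, repr v].

Let qoppE x : qopp (lie_quot_pi x) = lie_quot_pi (- x).
Proof.
by apply/lie_quot_piP; rewrite -opprD; apply: IN; exact: repr_pi.
Qed.
Let qaddE x y :
  qadd (lie_quot_pi x) (lie_quot_pi y) = lie_quot_pi (x + y).
Proof.
by apply/lie_quot_piP; rewrite opprD addrACA; apply: ID; exact: repr_pi.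
Qed.
Let qscaleE a x : qscale a (lie_quot_pi x) = lie_quot_pi (a *: x).
Proof. by apply/lie_quot_piP; rewrite -scalerBr; apply: IZ; exact: repr_pi. Qed.
Let qbrE x y :
  qbr (lie_quot_pi x) (lie_quot_pi y) = lie_quot_pi [lie x, y].
Proof.
apply/lie_quot_piP; set x' := repr _; set y' := repr _.
have -> : [lie x', y'] - [lie x, y] = [lie x' - x, y'] + [lie x, y' - y].
  by rewrite liebDl liebDr liebNl liebNr addrA addrNK.
by apply: ID; [apply: IBl | apply: IBr]; exact: repr_pi.
Qed.

Let qaddA : associative qadd.
Proof.
elim/lie_quot_piW=> x; elim/lie_quot_piW=> y; elim/lie_quot_piW=> z.
by rewrite !qaddE addrA.
Qed.
Let qaddC : commutative qadd.
Proof.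
by elim/lie_quot_piW=> x; elim/lie_quot_piW=> y; rewrite !qaddE addrC.
Qed.
Let qadd0 : left_id qzero qadd.
Proof. by elim/lie_quot_piW=> x; rewrite /qzero qaddE add0r. Qed.
Let qaddN : left_inverse qzero qopp qadd.
Proof. by elim/lie_quot_piW=> x; rewrite qoppE qaddE addNr. Qed.

HB.instance Definition _ :=
  GRing.isZmodule.Build lie_quot qaddA qaddC qadd0 qaddN.

Let piD x y : lie_quot_pi (x + y) = lie_quot_pi x + lie_quot_pi y.
Proof. by rewrite -qaddE. Qed.

Let qscaleA a b v : qscale a (qscale b v) = qscale (a * b) v.
Proof. by elim/lie_quot_piW: v => x; rewrite !qscaleE scalerA. Qed.
Let qscale1 : left_id 1 qscale.
Proof. by elim/lie_quot_piW=> x; rewrite qscaleE scale1r. Qed.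
Let qscaleDr : right_distributive qscale +%R.
Proof.
move=> a; elim/lie_quot_piW=> x; elim/lie_quot_piW=> y.
by rewrite -piD !qscaleE -piD scalerDr.
Qed.
Let qscaleDl v : {morph qscale^~ v : a b / a + b}.
Proof.
by move=> a b; elim/lie_quot_piW: v => x; rewrite !qscaleE -piD scalerDl.
Qed.

HB.instance Definition _ := GRing.Zmodule_isLmodule.Build k lie_quot
  qscaleA qscale1 qscaleDr qscaleDl.

Lemma lie_quot_pi_linear : linear lie_quot_pi.
Proof. by move=> a x y; rewrite -qaddE -qscaleE. Qed.

Let qbr_linl a u v w : qbr (a *: u + v) w = a *: qbr u w + qbr v w.
Proof.
elim/lie_quot_piW: u => x; elim/lie_quot_piW: v => y.
elim/lie_quot_piW: w => z.
by rewrite -lie_quot_pi_linear !qbrE -lie_quot_pi_linear lieb_linearl.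
Qed.
Let qbr_linr a u v w : qbr w (a *: u + v) = a *: qbr w u + qbr w v.
Proof.
elim/lie_quot_piW: u => x; elim/lie_quot_piW: v => y.
elim/lie_quot_piW: w => z.
by rewrite -lie_quot_pi_linear !qbrE -lie_quot_pi_linear lieb_linearr.
Qed.
Let qbrr u : qbr u u = 0.
Proof. by elim/lie_quot_piW: u => x; rewrite qbrE liebb. Qed.
Let qbr_jacobi u v w :
  qbr u (qbr v w) + qbr v (qbr w u) + qbr w (qbr u v) = 0.
Proof.
elim/lie_quot_piW: u => x; elim/lie_quot_piW: v => y.
elim/lie_quot_piW: w => z.
by rewrite !qbrE -!piD lieb_jacobi.
Qed.

HB.instance Definition _ := Lmodule_isLie.Build k lie_quot
  qbr_linl qbr_linr qbrr qbr_jacobi.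

Lemma lie_quot_pi_hom : lie_hom lie_quot_pi.
Proof.
by split; [exact: lie_quot_pi_linear | move=> x y; rewrite -qbrE].
Qed.

Lemma lie_quot_pi_ker : lie_ker lie_quot_pi = I.
Proof.
apply/seteqP; split=> x /=; rewrite /lie_ker /= => h.
  by rewrite -[x]subr0; apply/lie_quot_piP.
by apply/lie_quot_piP; rewrite subr0.
Qed.

End LieQuotient.

(* The free Lie algebra on X is the algebra of formal terms over X modulo the
   congruence generated by the identities that define Lie k-algebras. *)

Inductive lterm (k : fieldType) (X : Type) : Type :=
| LGen of X
| LZero
| LOpp of lterm k X
| LAdd of lterm k X & lterm k X
| LScale of k & lterm k X
| LBr of lterm k X & lterm k X.

Arguments LGen {k X}.
Arguments LZero {k X}.

HB.instance Definition _ (k : fieldType) (X : Type) := gen_eqMixin (lterm k X).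
HB.instance Definition _ (k : fieldType) (X : Type) :=
  gen_choiceMixin (lterm k X).

Inductive lterm_eq (k : fieldType) (X : Type) : lterm k X -> lterm k X -> Prop :=
| lteq_refl s : lterm_eq s s
| lteq_sym s t : lterm_eq s t -> lterm_eq t s
| lteq_trans s t u : lterm_eq s t -> lterm_eq t u -> lterm_eq s u
| lteq_opp s s' : lterm_eq s s' -> lterm_eq (LOpp s) (LOpp s')
| lteq_add s s' t t' :
    lterm_eq s s' -> lterm_eq t t' -> lterm_eq (LAdd s t) (LAdd s' t')
| lteq_scale a s s' : lterm_eq s s' -> lterm_eq (LScale a s) (LScale a s')
| lteq_br s s' t t' :
    lterm_eq s s' -> lterm_eq t t' -> lterm_eq (LBr s t) (LBr s' t')
| lteq_addA s t u : lterm_eq (LAdd s (LAdd t u)) (LAdd (LAdd s t) u)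
| lteq_addC s t : lterm_eq (LAdd s t) (LAdd t s)
| lteq_add0 s : lterm_eq (LAdd LZero s) s
| lteq_addN s : lterm_eq (LAdd (LOpp s) s) LZero
| lteq_scaleA a b s : lterm_eq (LScale a (LScale b s)) (LScale (a * b) s)
| lteq_scale1 s : lterm_eq (LScale 1 s) s
| lteq_scaleDr a s t :
    lterm_eq (LScale a (LAdd s t)) (LAdd (LScale a s) (LScale a t))
| lteq_scaleDl a b s :
    lterm_eq (LScale (a + b) s) (LAdd (LScale a s) (LScale b s))
| lteq_brl a s t u :
    lterm_eq (LBr (LAdd (LScale a s) t) u) (LAdd (LScale a (LBr s u)) (LBr t u))
| lteq_brr a s t u :
    lterm_eq (LBr u (LAdd (LScale a s) t)) (LAdd (LScale a (LBr u s)) (LBr u t))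
| lteq_brxx s : lterm_eq (LBr s s) LZero
| lteq_jacobi s t u :
    lterm_eq
      (LAdd (LAdd (LBr s (LBr t u)) (LBr t (LBr u s))) (LBr u (LBr s t))) LZero.

Section FreeLie.
Variables (k : fieldType) (X : Type).
Implicit Types s t : lterm k X.

Definition lterm_eqb : rel (lterm k X) := fun s t => `[< lterm_eq s t >].

Lemma lterm_eqb_class : equiv_class_of lterm_eqb.
Proof.
split=> [s|s t|t s u].
- by apply/asboolP; exact: lteq_refl.
- by apply/asboolP/asboolP => h; exact: lteq_sym.
- by move=> /asboolP h1 /asboolP h2; apply/asboolP; exact: lteq_trans h1 h2.
Qed.

Canonical lterm_eqb_equiv := EquivRelPack lterm_eqb_class.
Canonical lterm_encModRel := defaultEncModRel lterm_eqb.

Definition freeLie : Type := {eq_quot lterm_eqb}.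

HB.instance Definition _ : EqQuotient (lterm k X) lterm_eqb freeLie :=
  EqQuotient.on freeLie.
HB.instance Definition _ := Choice.on freeLie.

Let pi (s : lterm k X) : freeLie := \pi_freeLie s.

Let piP s t : pi s = pi t <-> lterm_eq s t.
Proof.
split=> [/eqP|h]; first by rewrite piE => /asboolP.
by apply/eqP; rewrite piE; apply/asboolP.
Qed.

Let piW (P : freeLie -> Prop) : (forall s, P (pi s)) -> forall u, P u.
Proof. by move=> h u; rewrite -[u]reprK; exact: h. Qed.

Let repr_pi s : lterm_eq (repr (pi s)) s.
Proof. by apply/piP; rewrite /pi reprK. Qed.

Let fzero : freeLie := pi LZero.
Let fopp (u : freeLie) := pi (LOpp (repr u)).
Let fadd (u v : freeLie) := pi (LAdd (repr u) (repr v)).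
Let fscale (a : k) (u : freeLie) := pi (LScale a (repr u)).
Let fbr (u v : freeLie) := pi (LBr (repr u) (repr v)).

Let foppE s : fopp (pi s) = pi (LOpp s).
Proof. by apply/piP/lteq_opp/repr_pi. Qed.
Let faddE s t : fadd (pi s) (pi t) = pi (LAdd s t).
Proof. by apply/piP/lteq_add; exact: repr_pi. Qed.
Let fscaleE a s : fscale a (pi s) = pi (LScale a s).
Proof. by apply/piP/lteq_scale/repr_pi. Qed.
Let fbrE s t : fbr (pi s) (pi t) = pi (LBr s t).
Proof. by apply/piP/lteq_br; exact: repr_pi. Qed.

Let faddA : associative fadd.
Proof.
elim/piW=> s; elim/piW=> t; elim/piW=> u.
by rewrite !faddE; apply/piP; exact: lteq_addA.
Qed.
Let faddC : commutative fadd.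
Proof.
by elim/piW=> s; elim/piW=> t; rewrite !faddE; apply/piP; exact: lteq_addC.
Qed.
Let fadd0 : left_id fzero fadd.
Proof. by elim/piW=> s; rewrite /fzero faddE; apply/piP; exact: lteq_add0. Qed.
Let faddN : left_inverse fzero fopp fadd.
Proof. by elim/piW=> s; rewrite foppE faddE; apply/piP; exact: lteq_addN. Qed.

HB.instance Definition _ :=
  GRing.isZmodule.Build freeLie faddA faddC fadd0 faddN.

Let pi0 : pi LZero = 0. Proof. by []. Qed.
Let piN s : pi (LOpp s) = - pi s.
Proof. by rewrite -foppE. Qed.
Let piD s t : pi (LAdd s t) = pi s + pi t.
Proof. by rewrite -faddE. Qed.

Let fscaleA a b v : fscale a (fscale b v) = fscale (a * b) v.
Proof. by elim/piW: v => s; rewrite !fscaleE; apply/piP/lteq_scaleA. Qed.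
Let fscale1 : left_id 1 fscale.
Proof. by elim/piW=> s; rewrite fscaleE; apply/piP/lteq_scale1. Qed.
Let fscaleDr : right_distributive fscale +%R.
Proof.
move=> a; elim/piW=> s; elim/piW=> t.
by rewrite -piD !fscaleE -piD; apply/piP/lteq_scaleDr.
Qed.
Let fscaleDl v : {morph fscale^~ v : a b / a + b}.
Proof.
by move=> a b; elim/piW: v => s; rewrite !fscaleE -piD; apply/piP/lteq_scaleDl.
Qed.

HB.instance Definition _ := GRing.Zmodule_isLmodule.Build k freeLie
  fscaleA fscale1 fscaleDr fscaleDl.

Let piZ a s : pi (LScale a s) = a *: pi s.
Proof. by rewrite -fscaleE. Qed.

Let fbr_linl a u v w : fbr (a *: u + v) w = a *: fbr u w + fbr v w.
Proof.
elim/piW: u => s; elim/piW: v => t; elim/piW: w => u.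
by rewrite -piZ -piD !fbrE -piZ -piD; apply/piP/lteq_brl.
Qed.
Let fbr_linr a u v w : fbr w (a *: u + v) = a *: fbr w u + fbr w v.
Proof.
elim/piW: u => s; elim/piW: v => t; elim/piW: w => u.
by rewrite -piZ -piD !fbrE -piZ -piD; apply/piP/lteq_brr.
Qed.
Let fbrr u : fbr u u = 0.
Proof. by elim/piW: u => s; rewrite fbrE; apply/piP/lteq_brxx. Qed.
Let fbr_jacobi u v w :
  fbr u (fbr v w) + fbr v (fbr w u) + fbr w (fbr u v) = 0.
Proof.
elim/piW: u => s; elim/piW: v => t; elim/piW: w => u.
by rewrite !fbrE -!piD; apply/piP/lteq_jacobi.
Qed.

HB.instance Definition _ := Lmodule_isLie.Build k freeLie
  fbr_linl fbr_linr fbrr fbr_jacobi.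

Let piB s t : pi (LBr s t) = [lie pi s, pi t].
Proof. by rewrite -fbrE. Qed.

Definition lgen (x : X) : freeLie := \pi_freeLie (LGen x).

Section Lift.
Variables (A : lieType k) (f : X -> A).

Fixpoint lterm_eval (s : lterm k X) : A :=
  match s with
  | LGen x => f x
  | LZero => 0
  | LOpp t => - lterm_eval t
  | LAdd t u => lterm_eval t + lterm_eval u
  | LScale a t => a *: lterm_eval t
  | LBr t u => [lie lterm_eval t, lterm_eval u]
  end.

Lemma lterm_eval_eq s t : lterm_eq s t -> lterm_eval s = lterm_eval t.
Proof.
elim=> //= {s t}; try by move=> *; congruence.
- by move=> s t u; rewrite addrA.
- by move=> s t; rewrite addrC.
- by move=> s; rewrite add0r.
- by move=> s; rewrite addNr.
- by move=> a b s; rewrite scalerA.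
- by move=> s; rewrite scale1r.
- by move=> a s t; rewrite scalerDr.
- by move=> a b s; rewrite scalerDl.
- by move=> a s t u; rewrite lieb_linearl.
- by move=> a s t u; rewrite lieb_linearr.
- by move=> s; rewrite liebb.
- by move=> s t u; rewrite lieb_jacobi.
Qed.

Definition lie_lift (u : freeLie) : A := lterm_eval (repr u).

Let lie_liftE s : lie_lift (pi s) = lterm_eval s.
Proof. exact/lterm_eval_eq/repr_pi. Qed.

Lemma lie_lift_gen x : lie_lift (lgen x) = f x.
Proof. exact: lie_liftE. Qed.

Lemma lie_lift_hom : lie_hom lie_lift.
Proof.
split=> [a|]; elim/piW=> s; elim/piW=> t.
  by rewrite -piZ -piD !lie_liftE.
by rewrite -piB !lie_liftE.
Qed.

Lemma lie_lift_uniq (g : freeLie -> A) :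
  lie_hom g -> (forall x, g (lgen x) = f x) -> g = lie_lift.
Proof.
move=> [g_lin g_br] g_gen; apply/funext; elim/piW=> s; rewrite lie_liftE.
have gD u v : g (u + v) = g u + g v.
  by have := g_lin 1 u v; rewrite !scale1r.
have g0 : g 0 = 0 by apply: (addrI (g 0)); rewrite -gD !addr0.
have gZ a u : g (a *: u) = a *: g u.
  by have := g_lin a u 0; rewrite g0 !addr0.
elim: s => [x||s IH|s IHs t IHt|a s IH|s IHs t IHt] /=.
- exact: g_gen.
- by rewrite pi0.
- by rewrite piN -scaleN1r gZ IH scaleN1r.
- by rewrite piD gD IHs IHt.
- by rewrite piZ gZ IH.
- by rewrite piB g_br IHs IHt.
Qed.

End Lift.

Inductive lie_monomial : nat -> freeLie -> Prop :=
| mono_gen x : lie_monomial 1 (lgen x)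
| mono_br m n u v :
    lie_monomial m u -> lie_monomial n v -> lie_monomial (m + n) [lie u, v].

(* L^j for L the free Lie algebra on X. *)
Definition lie_deg_ge (j : nat) : set freeLie :=
  lin_span [set u | exists2 n, (j <= n)%N & lie_monomial n u].

End FreeLie.

Arguments lgen {k X} x.
Arguments lie_deg_ge k X j : clear implicits.

(* lie_twist phi H has the carrier, addition and bracket of H, and the
   scalar a acts on it as phi a acts on H. *)
Definition lie_twist (k : fieldType) (phi : {rmorphism k -> k})
  (H : lieType k) : Type := H.

Section LieTwist.
Variables (k : fieldType) (phi : {rmorphism k -> k}) (H : lieType k).

HB.instance Definition _ := GRing.Zmodule.copy (lie_twist phi H) H.

Let tscale (a : k) (h : lie_twist phi H) : lie_twist phi H :=
  (phi a *: (h : H) : H).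

Let tscaleA a b v : tscale a (tscale b v) = tscale (a * b) v.
Proof. by rewrite /tscale scalerA rmorphM. Qed.
Let tscale1 : left_id 1 tscale.
Proof. by move=> v; rewrite /tscale rmorph1 scale1r. Qed.
Let tscaleDr : right_distributive tscale +%R.
Proof. by move=> a u v; rewrite /tscale scalerDr. Qed.
Let tscaleDl v : {morph tscale^~ v : a b / a + b}.
Proof. by move=> a b; rewrite /tscale rmorphD scalerDl. Qed.

HB.instance Definition _ := GRing.Zmodule_isLmodule.Build k (lie_twist phi H)
  tscaleA tscale1 tscaleDr tscaleDl.

Let tbr (u v : lie_twist phi H) : lie_twist phi H := [lie (u : H), (v : H)].

Let tbr_linl (a : k) (u v w : lie_twist phi H) :
  tbr (a *: u + v) w = a *: tbr u w + tbr v w.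
Proof. exact: (@lieb_linearl k H). Qed.
Let tbr_linr (a : k) (u v w : lie_twist phi H) :
  tbr w (a *: u + v) = a *: tbr w u + tbr w v.
Proof. exact: (@lieb_linearr k H). Qed.
Let tbrr (u : lie_twist phi H) : tbr u u = 0.
Proof. exact: (@liebb k H). Qed.
Let tbr_jacobi (u v w : lie_twist phi H) :
  tbr u (tbr v w) + tbr v (tbr w u) + tbr w (tbr u v) = 0.
Proof. exact: (@lieb_jacobi k H). Qed.

HB.instance Definition _ := Lmodule_isLie.Build k (lie_twist phi H)
  tbr_linl tbr_linr tbrr tbr_jacobi.

End LieTwist.

(* S''_H for a subset S of the free algebra F. *)
Definition galois_closure (k : fieldType) (F H : lieType k) (S : set F) : set F :=
  \bigcap_(mu in [set mu : F -> H | lie_hom mu /\ S `<=` lie_ker mu]) lie_ker mu.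

Arguments galois_closure {k F} H S.

(* The countable set X_0 is nat. *)
Definition geom_equiv (k : fieldType) (H1 H2 : lieType k) : Prop :=
  forall (X : {fset nat}) (S : set (freeLie k X)),
    galois_closure H1 S = galois_closure H2 S.

(* Main.v *)
(** The word-coefficient functionals on the free Lie algebra on x1, x2 are
    realised by representations in strictly upper triangular 6 x 6 matrices: the
    top right entry of the image of u is the coefficient in u of a word of
    length 5.  Modulo L^6 the ideal T is the line spanned by t.  A homomorphism
    to the twisted algebra that kills t sends x1, x2 to elements with linear
    parts y1 = a x1 + b x2, y2 = c x1 + d x2 such that
    phi(lambda) u1(y1, y2) + u2(y1, y2) is proportional to t = lambda u1 + u2,
    where u1 = [x1,[x1,[[x1,x2],x2]]] and u2 = [[x1,[x1,x2]],[x1,x2]].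
    Comparing coefficients of words: if a d - b c <> 0 then (a, b, c, d) is
    diagonal or antidiagonal, the second case is impossible, and the first one
    forces phi(lambda) = lambda.  Hence a d - b c = 0, which makes u1(y1, y2)
    vanish modulo L^6, although u1 is not in T. *)
Require Import Defs.
From HB Require Import structures.
From mathcomp Require Import all_boot all_order all_algebra.
From mathcomp Require Import finmap.
From mathcomp Require Import boolp classical_sets.
From mathcomp Require Import ring zify.

Set Implicit Arguments.
Unset Strict Implicit.
Unset Printing Implicit Defensive.

Import GRing.Theory.

Local Open Scope classical_set_scope.
Local Open Scope ring_scope.

(** * Elementary rules for homomorphisms and subspaces *)

Section LieHom.
Variables (k : fieldType) (U V : lieType k) (f : U -> V).
Hypothesis f_hom : lie_hom f.

Lemma lie_homD u v : f (u + v) = f u + f v.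
Proof. by have := f_hom.1 1 u v; rewrite !scale1r. Qed.

Lemma lie_hom0 : f 0 = 0.
Proof. by apply: (addrI (f 0)); rewrite -lie_homD !addr0. Qed.

Lemma lie_homZ a u : f (a *: u) = a *: f u.
Proof. by have := f_hom.1 a u 0; rewrite lie_hom0 !addr0. Qed.

Lemma lie_homb u v : f [lie u, v] = [lie f u, f v].
Proof. exact: f_hom.2. Qed.

Lemma comp_lie_hom (W : lieType k) (g : V -> W) :
  lie_hom g -> lie_hom (g \o f).
Proof.
move=> [g_lin g_br]; have [f_lin f_br] := f_hom.
by split=> [a u v|u v] /=; rewrite ?f_lin ?f_br ?g_lin ?g_br.
Qed.

End LieHom.

Section Subspace.
Variables (k : fieldType) (L : lieType k) (S : set L).
Hypothesis S_sub : is_subspace S.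

Lemma subspaceD u v : S u -> S v -> S (u + v).
Proof. by rewrite -{2}[u]scale1r; exact: S_sub.2. Qed.

Lemma subspaceZ a u : S u -> S (a *: u).
Proof. by move=> Su; rewrite -[_ *: _]addr0; exact: S_sub.2 Su S_sub.1. Qed.

Lemma subspaceB u v : S u -> S v -> S (u - v).
Proof. by move=> Su Sv; rewrite -scaleN1r; apply/subspaceD/subspaceZ. Qed.

End Subspace.

Lemma lin_span_subspace (k : fieldType) (L : lieType k) (S : set L) :
  is_subspace (lin_span S).
Proof.
split=> [A [[A0 _] _] //|a u v Su Sv A hA].
by have [[_ h] _] := hA; apply: h; [exact: Su | exact: Sv].
Qed.

(** * Term induction and the degree filtration of a free Lie algebra *)

Section FreeLieDegree.
Variables (k : fieldType) (X : Type).
Local Notation L := (freeLie k X).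
Local Notation D := (lie_deg_ge k X).
Implicit Types u v : L.

(** The identity is the unique lift of the generators, so every element is the value of a term and
    induction on terms applies. *)
Lemma freeLie_ind (P : L -> Prop) :
  (forall x, P (lgen x)) -> P 0 -> (forall u v, P u -> P v -> P (u + v)) ->
  (forall a u, P u -> P (a *: u)) ->
  (forall u v, P u -> P v -> P [lie u, v]) -> forall u, P u.
Proof.
move=> Pgen P0 PD PZ PB u.
have -> : u = lterm_eval lgen (repr u).
  by rewrite -[LHS]/(idfun u) (@lie_lift_uniq _ _ _ (@lgen k X) idfun).
elim: (repr u) => //= [s IH|s IHs t IHt|a s IH|s IHs t IHt].
- by rewrite -scaleN1r; exact: PZ.
- exact: PD.
- exact: PZ.
- exact: PB.
Qed.

Lemma deg_subspace n : is_subspace (D n).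
Proof. exact: lin_span_subspace. Qed.

Lemma deg_mono m n u : (m <= n)%N -> lie_monomial n u -> D m u.
Proof. by move=> le_mn mu A [_ sA]; apply: sA; exists n. Qed.

Lemma deg_ind n (P : set L) : is_subspace P ->
  (forall m u, (n <= m)%N -> lie_monomial m u -> P u) -> D n `<=` P.
Proof. by move=> Psub Pm u Du; apply: Du; split=> // v [m nm mv]; apply: Pm mv. Qed.

Lemma deg_le m n u : (m <= n)%N -> D n u -> D m u.
Proof.
move=> le_mn; apply: deg_ind; first exact: deg_subspace.
by move=> p v le_np; apply: deg_mono; exact: leq_trans le_np.
Qed.

Lemma deg_br m n u v : D m u -> D n v -> D (m + n) [lie u, v].
Proof.
move=> + Dv; move: u; apply: deg_ind => [|p u le_mp mu].
  split=> [|a x y Dx Dy]; first by rewrite /= lieb0l; exact: (deg_subspace _).1.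
  by rewrite /= lieb_linearl; exact: (deg_subspace _).2.
move: v Dv; apply: deg_ind => [|q v le_nq mv].
  split=> [|a x y Dx Dy]; first by rewrite /= lieb0r; exact: (deg_subspace _).1.
  by rewrite /= lieb_linearr; exact: (deg_subspace _).2.
by apply: (@deg_mono _ (p + q)); [exact: leq_add | exact: mono_br].
Qed.

Lemma deg_gen x : D 1 (lgen x).
Proof. by apply: (@deg_mono 1 1) => //; exact: mono_gen. Qed.

Lemma deg1 u : D 1 u.
Proof.
have D1 := deg_subspace 1; elim/freeLie_ind: u => [x||u v|a u|u v].
- exact: deg_gen.
- exact: D1.1.
- exact: subspaceD.
- exact: subspaceZ.
- by move=> Du Dv; apply: (@deg_le 1 2) => //; exact: (@deg_br 1 1).
Qed.

(** Leading parts of brackets depend only on leading parts of the factors: the difference telescopes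
    into two brackets, each with one factor of raised degree. *)
Lemma deg_br_congr i j u u' v v' : D i u -> D j v' ->
  D i.+1 (u - u') -> D j.+1 (v - v') ->
  D (i + j).+1 ([lie u, v] - [lie u', v']).
Proof.
move=> Du Dv' Duu Dvv.
have -> : [lie u, v] - [lie u', v'] = [lie u, v - v'] + [lie u - u', v'].
  by rewrite liebDl liebDr liebNl liebNr addrA addrNK.
apply: (subspaceD (deg_subspace _)); first by rewrite -addnS; exact: deg_br.
by rewrite -addSn; exact: deg_br.
Qed.

End FreeLieDegree.

(** * Square matrices under the commutator, and weighted superdiagonals *)

Definition gl_lie (k : fieldType) (n : nat) : Type := 'M[k]_n.

Section GlLie.
Variables (k : fieldType) (n : nat).

HB.instance Definition _ := GRing.Lmodule.copy (gl_lie k n) 'M[k]_n.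

Let cbr (A B : gl_lie k n) : gl_lie k n :=
  ((A : 'M_n) *m (B : 'M_n) - (B : 'M_n) *m (A : 'M_n) : 'M_n).

Let cbr_linl a A B C : cbr (a *: A + B) C = a *: cbr A C + cbr B C.
Proof.
rewrite /cbr mulmxDl mulmxDr -scalemxAl -scalemxAr.
by rewrite scalerBr opprD addrACA.
Qed.
Let cbr_linr a A B C : cbr C (a *: A + B) = a *: cbr C A + cbr C B.
Proof.
rewrite /cbr mulmxDl mulmxDr -scalemxAl -scalemxAr.
by rewrite scalerBr opprD addrACA.
Qed.
Let cbrr A : cbr A A = 0.
Proof. exact: subrr. Qed.
Let cbr_jacobi A B C : cbr A (cbr B C) + cbr B (cbr C A) + cbr C (cbr A B) = 0.
Proof.
(* Only six distinct triple products occur; taken as opaque matrices, they cancel entrywise. *)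
rewrite /cbr !mulmxBl !mulmxBr !mulmxA; apply/matrixP => i j.
move: (_ *m _ *m _) (_ *m _ *m _) (_ *m _ *m _) => p q r.
move: (_ *m _ *m _) (_ *m _ *m _) (_ *m _ *m _) => s t u.
by rewrite !mxE; ring.
Qed.

HB.instance Definition _ := Lmodule_isLie.Build k (gl_lie k n)
  cbr_linl cbr_linr cbrr cbr_jacobi.

Lemma gl_lieE (A B : gl_lie k n) :
  [lie A, B] = (A : 'M_n) *m (B : 'M_n) - (B : 'M_n) *m (A : 'M_n) :> 'M_n.
Proof. by []. Qed.

Definition above_diag (d : nat) (A : gl_lie k n) : Prop :=
  forall i j : 'I_n, (j < i + d)%N -> (A : 'M_n) i j = 0.

Lemma above_diag_subspace d : is_subspace (above_diag d).
Proof.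
split=> [i j _|a A B hA hB i j lt_j]; first by rewrite mxE.
by rewrite !mxE hA // hB // mulr0 addr0.
Qed.

Lemma above_diag_mul d e (A B : gl_lie k n) :
  above_diag d A -> above_diag e B -> above_diag (d + e) ((A : 'M_n) *m (B : 'M_n)).
Proof.
move=> hA hB i j lt_j; rewrite mxE big1 // => l _.
have [lt_l|le_l] := ltnP l (i + d); first by rewrite hA // mul0r.
by rewrite hB ?mulr0 //; apply: leq_trans lt_j _; rewrite addnA leq_add2r.
Qed.

Lemma above_diag_br d e A B :
  above_diag d A -> above_diag e B -> above_diag (d + e) [lie A, B].
Proof.
move=> hA hB; rewrite gl_lieE; apply: (subspaceB (above_diag_subspace _)).
  exact: above_diag_mul.
by rewrite addnC; exact: above_diag_mul.
Qed.

Definition diag_band (d : nat) (f : nat -> k) : gl_lie k n :=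
  \matrix_(i, j) (if j == (i + d)%N :> nat then f i else 0).

(** The weights of a commutator of bands: in a product, the second weight is read at an index moved
    by the offset of the first. *)
Definition band_br (d e : nat) (f g : nat -> k) (i : nat) : k :=
  f i * g (i + d)%N - g i * f (i + e)%N.

Lemma diag_band_mul d e f g :
  (diag_band d f : 'M_n) *m (diag_band e g : 'M_n) =
  diag_band (d + e) (fun i => f i * g (i + d)%N).
Proof.
apply/matrixP => i j; rewrite !mxE; case: eqP => [def_j|ne_j].
  (* The only contributing middle index is [i + d], in range because [j] lies [e] further. *)
  have lt_l : (i + d < n)%N by have := ltn_ord j; lia.
  rewrite (bigD1 (Ordinal lt_l)) //= !mxE eqxx def_j addnA eqxx big1 ?addr0 //.
  move=> l ne_l; rewrite !mxE; case: eqP => [def_l|]; last by rewrite mul0r.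
  by case/eqP: ne_l; apply: val_inj.
rewrite big1 // => l _; rewrite !mxE.
case: eqP => [def_l|]; last by rewrite mul0r.
by case: eqP => [def_j|]; [lia | rewrite mulr0].
Qed.

Lemma diag_band_br d e f g :
  [lie diag_band d f, diag_band e g] = diag_band (d + e) (band_br d e f g).
Proof.
rewrite gl_lieE !diag_band_mul; apply/matrixP => i j.
by rewrite !mxE (addnC e d); case: ifP; rewrite ?subr0.
Qed.

Lemma diag_band_linear d a b f g :
  a *: diag_band d f + b *: diag_band d g =
  diag_band d (fun i => a * f i + b * g i).
Proof. by apply/matrixP => i j; rewrite !mxE; case: ifP; rewrite ?mulr0 ?addr0. Qed.

End GlLie.

(** * The two quintic brackets modulo degree 6 *)

Definition quintic1 (k : fieldType) (A : lieType k) (y1 y2 : A) : A :=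
  [lie y1, [lie y1, [lie [lie y1, y2], y2]]].

Definition quintic2 (k : fieldType) (A : lieType k) (y1 y2 : A) : A :=
  [lie [lie y1, [lie y1, y2]], [lie y1, y2]].

Lemma quintic_hom (k : fieldType) (A B : lieType k) (f : A -> B) y1 y2 :
  lie_hom f -> f (quintic1 y1 y2) = quintic1 (f y1) (f y2) /\
  f (quintic2 y1 y2) = quintic2 (f y1) (f y2).
Proof. by move=> fh; rewrite /quintic1 /quintic2 !(lie_homb fh). Qed.

Section TwoGenerators.
Variable k : fieldType.
Local Notation L := (freeLie k 'I_2).
Local Notation D := (lie_deg_ge k 'I_2).
Local Notation x1 := (lgen ord0 : L).
Local Notation x2 := (lgen ord_max : L).
Implicit Types (u z : L) (al be : nat -> k).

Lemma linear_part z : exists a b, D 2 (z - (a *: x1 + b *: x2)).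
Proof.
have D2 := @deg_subspace k 'I_2 2.
elim/freeLie_ind: z => [x||u v [a [b hu]] [c [d hv]]|e u [a [b hu]]|u v _ _].
- case: (unliftP ord0 x) => [j ->|->].
    exists 0, 1; rewrite scale0r scale1r add0r.
    have -> : lift ord0 j = ord_max by apply: val_inj; rewrite /= (ord1 j).
    by rewrite subrr; exact: D2.1.
  by exists 1, 0; rewrite scale0r scale1r addr0 subrr; exact: D2.1.
- by exists 0, 0; rewrite !scale0r addr0 subrr; exact: D2.1.
- exists (a + c), (b + d); have := subspaceD D2 hu hv.
  by rewrite addrACA -opprD !scalerDl (addrACA (a *: _)).
- exists (e * a), (e * b); have := subspaceZ D2 e hu.
  by rewrite scalerBr scalerDr !scalerA.
- exists 0, 0; rewrite !scale0r addr0 subr0.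
  by apply: (@deg_br _ _ 1 1); exact: deg1.
Qed.

(** Passing to linear parts costs one degree in each bracket, by repeated use of [deg_br_congr]. *)
Lemma quintic_congr (y1 y2 z1 z2 : L) :
  D 2 (z1 - y1) -> D 2 (z2 - y2) ->
  D 6 (quintic1 z1 z2 - quintic1 y1 y2) /\ D 6 (quintic2 z1 z2 - quintic2 y1 y2).
Proof.
move=> h1 h2.
have d1 := deg1; have dbr m n u v := @deg_br k 'I_2 m n u v.
have w12 := deg_br_congr (d1 _ _ _) (d1 _ _ _) h1 h2.
split.
  apply: (@deg_br_congr _ _ 1 4) => //.
    by apply: (dbr 1 3) => //; apply: (dbr 2 1) => //; exact: (dbr 1 1).
  apply: (@deg_br_congr _ _ 1 3) => //.
    by apply: (dbr 2 1) => //; exact: (dbr 1 1).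
  by apply: (@deg_br_congr _ _ 2 1) => //; exact: (dbr 1 1).
apply: (@deg_br_congr _ _ 3 2) => //.
- by apply: (dbr 1 2) => //; exact: (dbr 1 1).
- exact: (dbr 1 1).
- by apply: (@deg_br_congr _ _ 1 2) => //; exact: (dbr 1 1).
Qed.

Lemma lin_br a b c d :
  [lie a *: x1 + b *: x2, c *: x1 + d *: x2] = (a * d - b * c) *: [lie x1, x2].
Proof.
rewrite !(liebDl, liebDr, liebZl, liebZr) !liebb !scaler0 addr0 add0r.
by rewrite (liebC x2) !scalerN !scalerA scalerBl.
Qed.

(** The inner bracket of the linear parts is the determinant times [[lie x1, x2]], so it
    vanishes. *)
Lemma quintic1_degenerate a b c d z1 z2 :
  D 2 (z1 - (a *: x1 + b *: x2)) -> D 2 (z2 - (c *: x1 + d *: x2)) ->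
  a * d - b * c = 0 -> D 6 (quintic1 z1 z2).
Proof.
move=> h1 h2 det0; have [+ _] := quintic_congr h1 h2.
by rewrite {2}/quintic1 lin_br det0 scale0r lieb0l !lieb0r subr0.
Qed.

Definition quintic (lambda : k) (A : lieType k) (y1 y2 : A) : A :=
  lambda *: quintic1 y1 y2 + quintic2 y1 y2.

Lemma deg_quintic lambda z1 z2 : D 5 (quintic lambda z1 z2).
Proof.
have d1 := @deg1 k 'I_2; have dbr m n u v := @deg_br k 'I_2 m n u v.
have d12 : D 2 [lie z1, z2] by exact: (dbr 1 1).
rewrite /quintic; apply: (subspaceD (@deg_subspace k _ 5)).
  apply: (subspaceZ (@deg_subspace k _ 5)).
  by apply: (dbr 1 4) => //; apply: (dbr 1 3) => //; exact: (dbr 2 1).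
by apply: (dbr 3 2) => //; exact: (dbr 1 2).
Qed.

(** The line through [t] plus [D 6] is already an ideal, since any bracket with [t] has degree at
    least 6. *)
Lemma ideal_span_top (t u : L) : D 5 t ->
  ideal_span ([set t] `|` D 6) u -> exists c, D 6 (u - c *: t).
Proof.
move=> t5 /(_ [set v | exists c, D 6 (v - c *: t)]); apply.
have D6 := @deg_subspace k 'I_2 6.
split; first split; first split.
- by exists 0; rewrite scale0r subrr; exact: D6.1.
- move=> a u1 u2 [c1 h1] [c2 h2]; exists (a * c1 + c2).
  by have := D6.2 a _ _ h1 h2; rewrite scalerBr addrACA -opprD scalerA -scalerDl.
- move=> x v [c h]; exists 0; rewrite scale0r subr0.
  rewrite -[v](subrK (c *: t)) liebDr liebZr; apply: (subspaceD D6).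
    by apply: (@deg_le _ _ 6 7) => //; apply: (@deg_br _ _ 1 6) => //; exact: deg1.
  by apply: (subspaceZ D6); apply: (@deg_br _ _ 1 5) => //; exact: deg1.
- move=> v [->|Dv]; first by exists 1; rewrite scale1r subrr; exact: D6.1.
  by exists 0; rewrite scale0r subr0.
Qed.

(** * Word coefficients read off from matrix representations *)

Definition band_rep al be : L -> gl_lie k 6 :=
  lie_lift (fun i => diag_band 6 1 (if i == ord0 then al else be)).

(* If al and be are the indicators of the positions of x1 and x2 in a word of
   length 5, this is the coefficient of that word in u. *)
Definition corner_coef al be u : k := (band_rep al be u : 'M_6) ord0 ord_max.

Lemma band_rep_hom al be : lie_hom (band_rep al be).
Proof. exact: lie_lift_hom. Qed.

Lemma corner_coef_linear al be e u v :
  corner_coef al be (e *: u + v) = e * corner_coef al be u + corner_coef al be v.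
Proof. by rewrite /corner_coef (band_rep_hom al be).1 !mxE. Qed.

(** A monomial of degree [m] maps on or above the [m]-th superdiagonal, and a matrix of size 6 has
    no sixth one. *)
Lemma corner_coef_deg6 al be u : D 6 u -> corner_coef al be u = 0.
Proof.
suff mono m v : lie_monomial m v -> above_diag m (band_rep al be v).
  move=> Du; suff : above_diag 6 (band_rep al be u) by apply.
  move: u Du; apply: deg_ind => [|m u le_6m mu].
    split=> [|a v w hv hw] /=.
      by rewrite (lie_hom0 (band_rep_hom al be)); exact: (@above_diag_subspace k 6 6).1.
    by rewrite (band_rep_hom al be).1; exact: (@above_diag_subspace k 6 6).2.
  by move=> i j lt_j; apply: (mono _ _ mu); apply: leq_trans lt_j _; rewrite leq_add2l.
elim=> {m u v} [x|m n u v _ hu _ hv].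
  rewrite /band_rep lie_lift_gen => i j lt_j; rewrite mxE.
  by case: eqP lt_j => // ->; rewrite ltnn.
by rewrite (lie_homb (band_rep_hom _ _)); exact: above_diag_br.
Qed.

(** The numbers given to [band_br] are the degrees of the two factors; the final 0 selects the first
    row. *)
Definition quintic1_coef (f g : nat -> k) : k :=
  band_br 1 4 f (band_br 1 3 f (band_br 2 1 (band_br 1 1 f g) g)) 0.

Definition quintic2_coef (f g : nat -> k) : k :=
  band_br 3 2 (band_br 1 2 f (band_br 1 1 f g)) (band_br 1 1 f g) 0.

(** A combination of the generators maps to a band of offset 1 whose weights combine linearly, so
    the bracket computation stays within bands. *)
Lemma corner_coef_quintic al be lambda a b c d :
  let f i := a * al i + b * be i in let g i := c * al i + d * be i in
  corner_coef al be (quintic lambda (a *: x1 + b *: x2) (c *: x1 + d *: x2)) =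
  lambda * quintic1_coef f g + quintic2_coef f g.
Proof.
move=> f g; have rh := band_rep_hom al be.
have rlin e1 e2 : band_rep al be (e1 *: x1 + e2 *: x2) =
    diag_band 6 1 (fun i => e1 * al i + e2 * be i).
  by rewrite rh.1 (lie_homZ rh) /band_rep !lie_lift_gen /= diag_band_linear.
rewrite /corner_coef (lie_homD rh) (lie_homZ rh).
have [-> ->] := quintic_hom (a *: x1 + b *: x2) (c *: x1 + d *: x2) rh.
by rewrite /quintic1 /quintic2 !rlin !diag_band_br !mxE.
Qed.

Lemma corner_coef_quintic_gen al be lambda :
  corner_coef al be (quintic lambda x1 x2) =
  lambda * quintic1_coef al be + quintic2_coef al be.
Proof.
have := corner_coef_quintic al be lambda 1 0 0 1.
rewrite !scale1r !scale0r addr0 add0r => ->.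
by rewrite /quintic1_coef /quintic2_coef /band_br; ring.
Qed.

(** Turns a coefficient equation into a chosen normal form; [s] is the sign, and [ring] checks the
    second premise. *)
Lemma eq0_of_eq (s x l r : k) : l = r -> x = s * (l - r) -> x = 0.
Proof. by move=> -> ->; rewrite subrr mulr0. Qed.

Lemma twisted_quintic_degenerate (lambda lambda' a b c d e : k) :
  lambda' != 0 -> lambda' != lambda ->
  D 6 (quintic lambda' (a *: x1 + b *: x2) (c *: x1 + d *: x2)
       - e *: quintic lambda x1 x2) ->
  a * d - b * c = 0.
Proof.
move=> l'_neq0 l'_neq inD6.
have key al be :
    let f i := a * al i + b * be i in let g i := c * al i + d * be i in
    lambda' * quintic1_coef f g + quintic2_coef f g =
    e * (lambda * quintic1_coef al be + quintic2_coef al be).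
  have := corner_coef_deg6 al be inD6.
  rewrite addrC -scaleNr corner_coef_linear corner_coef_quintic corner_coef_quintic_gen.
  by rewrite mulNr addrC => /eqP; rewrite subr_eq0 => /eqP.
(* The lists are indicators of the positions of [x1] and [x2]; the digits in each name below spell
   the word. *)
have words s1 s2 := key (nth 0 s1) (nth 0 s2).
have w21111 := words [:: 0; 1; 1; 1; 1] [:: 1; 0; 0; 0; 0].
have w12222 := words [:: 1; 0; 0; 0; 0] [:: 0; 1; 1; 1; 1].
have w11222 := words [:: 1; 1; 0; 0; 0] [:: 0; 0; 1; 1; 1].
have w22111 := words [:: 0; 0; 1; 1; 1] [:: 1; 1; 0; 0; 0].
have w11212 := words [:: 1; 1; 0; 1; 0] [:: 0; 0; 1; 0; 1].
rewrite /quintic1_coef /quintic2_coef /band_br /=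
  in w21111 w12222 w11222 w22111 w11212.
apply/eqP/negPn/negP; set dt := a * d - b * c => dt_neq0.
(* The first two words contain one generator only once. They are absent from the right side and from
   [quintic2], which has two factors [[lie x1, x2]] up to scalars. *)
have e1 : lambda' * dt * a * a * c = 0.
  by apply: (@eq0_of_eq (-1) _ _ _ w21111); rewrite /dt; ring.
have e2 : lambda' * dt * b * b * d = 0.
  by apply: (@eq0_of_eq 1 _ _ _ w12222); rewrite /dt; ring.
move/eqP: e1; rewrite !mulf_eq0 (negPf l'_neq0) (negPf dt_neq0) /= orbb.
move/eqP: e2; rewrite !mulf_eq0 (negPf l'_neq0) (negPf dt_neq0) /= orbb.
(* In order: first row zero, diagonal, antidiagonal, second row zero. The outer two contradict
   [dt_neq0]. *)
case/orP=> /eqP b_or_d; case/orP=> /eqP a_or_c; subst.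
- by case/eqP: dt_neq0; rewrite /dt; ring.
- have e3 : lambda' * a ^+ 3 * d ^+ 2 - e * lambda = 0.
    by apply: (@eq0_of_eq 1 _ _ _ w22111); ring.
  (* The word 22111 has coefficients 1 and 0 in [quintic1] and [quintic2]; the word 11212 has -2 and
     1. *)
  have e4 : a ^+ 3 * d ^+ 2 - e - 2%:R * (lambda' * a ^+ 3 * d ^+ 2 - e * lambda) = 0.
    by apply: (@eq0_of_eq 1 _ _ _ w11212); ring.
  rewrite e3 mulr0 subr0 in e4; move/subr0_eq: e4 => def_e.
  have : a ^+ 3 * d ^+ 2 * (lambda' - lambda) = 0.
    by rewrite -[RHS]e3 -def_e; ring.
  rewrite /dt mulr0 subr0 mulf_eq0 negb_or in dt_neq0.
  case/andP: dt_neq0 => a_neq0 d_neq0; apply/eqP.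
  by rewrite !mulf_eq0 (negPf a_neq0) (negPf d_neq0) subr_eq0.
(* The left side now has degree 2 in [x1] and 3 in [x2], while the right side has these degrees
   swapped. *)
- have : lambda' * b ^+ 3 * c ^+ 2 = 0.
    by apply: (@eq0_of_eq 1 _ _ _ w11222); ring.
  rewrite /dt mul0r sub0r oppr_eq0 mulf_eq0 negb_or in dt_neq0.
  case/andP: dt_neq0 => b_neq0 c_neq0; apply/eqP.
  by rewrite !mulf_eq0 (negPf l'_neq0) (negPf b_neq0) (negPf c_neq0).
- by case/eqP: dt_neq0; rewrite /dt; ring.
Qed.

(** The same two words give [e * lambda = 1] and then [e = 0]. *)
Lemma quintic1_neq_quintic (lambda e : k) :
  ~ D 6 (quintic1 x1 x2 - e *: quintic lambda x1 x2).
Proof.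
move=> inD6; have key al be :
    quintic1_coef al be = e * (lambda * quintic1_coef al be + quintic2_coef al be).
  have := corner_coef_deg6 al be inD6.
  rewrite addrC -scaleNr corner_coef_linear corner_coef_quintic_gen.
  (* The values 1 and 0 of the parameter isolate the coefficients of the two quintics. *)
  have := corner_coef_linear al be 1 (quintic1 x1 x2) (quintic2 x1 x2).
  have := corner_coef_quintic_gen al be 1; rewrite /quintic scale1r => -> e1.
  have := corner_coef_quintic_gen al be 0; rewrite /quintic scale0r add0r => e2.
  move: e1; rewrite e2 mul0r add0r !mul1r => /addIr <-.
  by rewrite mulNr addrC => /eqP; rewrite subr_eq0 => /eqP.
have w22111 := key (nth 0 [:: 0; 0; 1; 1; 1]) (nth 0 [:: 1; 1; 0; 0; 0]).
have w11212 := key (nth 0 [:: 1; 1; 0; 1; 0]) (nth 0 [:: 0; 0; 1; 0; 1]).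
rewrite /quintic1_coef /quintic2_coef /band_br /= in w22111 w11212.
have e1 : e * lambda - 1 = 0.
  by apply: (@eq0_of_eq (-1) _ _ _ w22111); ring.
have e0 : e - 2%:R * (e * lambda - 1) = 0.
  by apply: (@eq0_of_eq (-1) _ _ _ w11212); ring.
rewrite e1 mulr0 subr0 in e0; move/eqP: e1.
by rewrite e0 mul0r sub0r oppr_eq0 oner_eq0.
Qed.

End TwoGenerators.

(** * Separation of the two closures *)

Theorem proposition5p4 (k : fieldType) (chark0 : [pchar k] =i pred0)
    (phi : {rmorphism k -> k}) (phi_bij : bijective phi)
    (phi_neq_id : (phi : k -> k) <> idfun)
    (lambda : k) (phi_lambda : phi lambda <> lambda) :
  let L := freeLie k 'I_2 in
  let x1 : L := lgen ord0 in
  let x2 : L := lgen ord_max in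
  let t : L :=
    lambda *: [lie x1, [lie x1, [lie [lie x1, x2], x2]]]
      + [lie [lie x1, [lie x1, x2]], [lie x1, x2]] in
  let T : lieIdeal L := ideal_gen ([set t] `|` lie_deg_ge k 'I_2 6) in
  let H : lieType k := lie_quot T in
  ~ geom_equiv H (lie_twist phi H).
Proof.
move=> L x1 x2 t T H equivH.
have T_top (u : L) : ideal_set T u -> exists e, lie_deg_ge k 'I_2 6 (u - e *: t).
  exact: (ideal_span_top (deg_quintic lambda x1 x2)).
have T6 (u : L) : lie_deg_ge k 'I_2 6 u -> ideal_set T u by move=> Du A [_]; apply; right.
have Tt : ideal_set T t by move=> A [_]; apply; left.
have pi_hom : lie_hom (lie_quot_pi T) by exact: lie_quot_pi_hom.
have pi_eq0 (u : L) : lie_quot_pi T u = 0 <-> ideal_set T u.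
  by have /seteqP[h1 h2] := lie_quot_pi_ker T; split; [exact: h1 | exact: h2].
pose X : {fset nat} := [fset 0%N; 1%N]%fset.
have X0 : 0%N \in X by rewrite !inE.
have X1 : 1%N \in X by rewrite !inE.
pose F := freeLie k X.
pose g1 : F := lgen [` X0]%fset; pose g2 : F := lgen [` X1]%fset.
pose f : F -> L := lie_lift (fun x : X => if val x == 0%N then x1 else x2).
have f_hom : lie_hom f by exact: lie_lift_hom.
have fg1 : f g1 = x1 by rewrite /f lie_lift_gen.
have fg2 : f g2 = x2 by rewrite /f lie_lift_gen.
pose S : set F := lie_ker (lie_quot_pi T \o f).
(* The map defining [S] is itself a test homomorphism, and it does not kill [quintic1 g1 g2]. *)
have : ~ galois_closure H S (quintic1 g1 g2).
  move/(_ (lie_quot_pi T \o f)) => hS.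
  have /pi_eq0/T_top [e] : lie_quot_pi T (f (quintic1 g1 g2)) = 0.
    by apply: hS; split; [exact: comp_lie_hom|].
  have [-> _] := quintic_hom g1 g2 f_hom; rewrite fg1 fg2.
  exact: quintic1_neq_quintic.
rewrite (equivH X S); apply=> mu [mu_hom S_mu].
have mu_t : mu (quintic lambda g1 g2) = 0.
  apply: S_mu; apply/pi_eq0; rewrite /quintic (lie_homD f_hom) (lie_homZ f_hom).
  by have [-> ->] := quintic_hom g1 g2 f_hom; rewrite fg1 fg2.
have [mu1 mu2] := quintic_hom g1 g2 mu_hom.
rewrite /lie_ker /= mu1.
move: mu_t; rewrite /quintic (lie_homD mu_hom) (lie_homZ mu_hom) mu1 mu2.
move: (mu g1) (mu g2) => h1 h2.
(* Read back in [H], the twist changes only the scalar, from [lambda] to [phi lambda]. *)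
change ((phi lambda *: (quintic1 (h1 : H) (h2 : H)) + quintic2 (h1 : H) (h2 : H) : H) = 0
  -> quintic1 (h1 : H) (h2 : H) = 0).
elim/lie_quot_piW: h1 => z1; elim/lie_quot_piW: h2 => z2.
have [<- <-] := quintic_hom z1 z2 pi_hom.
rewrite -(lie_homZ pi_hom) -(lie_homD pi_hom) => /pi_eq0/T_top [e he].
apply/pi_eq0; refine (T6 _ _).
have [a [b hz1]] := linear_part z1; have [c [d hz2]] := linear_part z2.
apply: (quintic1_degenerate hz1 hz2).
apply: (@twisted_quintic_degenerate _ lambda (phi lambda) a b c d e).
(* A zero [lambda] would be fixed by [phi]. *)
- rewrite fmorph_eq0; apply/eqP => l0; apply: phi_lambda.
  by rewrite l0 rmorph0.
- exact/eqP.
(* The relation [he] for [z1], [z2] is carried over to their linear parts modulo [D 6]. *)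
have [c1 c2] := quintic_congr hz1 hz2.
have D6 := @deg_subspace k 'I_2 6.
have := subspaceB D6 he (subspaceD D6 (subspaceZ D6 (phi lambda) c1) c2).
have cancel (p p' q : L) : p - q - (p - p') = p' - q.
  by rewrite opprB addrC addrA subrK.
by rewrite scalerBr addrACA -opprD cancel.
Qed.
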